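(* Let $d\in\mathbb{N}$ and let $\mathcal{P}(L)$ be an $N$-element lattice point set in $[0,1)^d$, arising from an integration lattice $L\subseteq\mathbb{R}^d$. Then $$J_N(\mathcal{P}(L))\le d\,2^{2(d+1)}\,\sigma(L).$$
   Context: An integration lattice $L$ in $\mathbb{R}^d$ is a discrete additive subgroup of $\mathbb{R}^d$ containing $\mathbb{Z}^d$. Its lattice point set is $\mathcal{P}(L):=L\cap[0,1)^d$, a finite set with $N=|\mathcal{P}(L)|$ elements. The spectral test $\sigma(L)$ is the largest distance between adjacent hyperplanes, taken over all families of parallel hyperplanes that cover $L$. Equivalently, $\sigma(L)=1/\min\{\|\boldsymbol{h}\|_2 : \boldsymbol{h}\in L^{\perp}\setminus\{\boldsymbol{0}\}\}$, where $L^{\perp}:=\{\boldsymbol{h}\in\mathbb{R}^d : \boldsymbol{h}\cdot\boldsymbol{x}\in\mathbb{Z}\text{ for all }\boldsymbol{x}\in L\}$ is the dual lattice and $\|\cdot\|_2$ is the Euclidean norm. The (normalized) isotropic discrepancy of an $N$-element point set $\mathcal{P}\subseteq[0,1)^d$ is $$J_N(\mathcal{P}):=\sup_{C}\left|\frac{|\mathcal{P}\cap C|}{N}-\mathrm{Vol}(C)\right|,$$ where the supremum is over all convex subsets $C\subseteq[0,1]^d$ and $\mathrm{Vol}$ is $d$-dimensional Lebesgue measure. *)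

(* Defs.v *)
From HB Require Import structures.
From mathcomp Require Import all_boot all_order all_algebra finmap.
From mathcomp Require Import all_classical all_reals all_analysis.

Set Implicit Arguments.
Unset Strict Implicit.
Unset Printing Implicit Defensive.
Import Order.TTheory GRing.Theory Num.Theory.
Import numFieldNormedType.Exports.

Local Open Scope classical_set_scope.
Local Open Scope ring_scope.

Section lebesgue_tuple.
Context {R : realType}.
Notation RR := (measurableTypeR R).

Definition tuple_cons (n : nat) (x : RR * n.-tuple RR) : n.+1.-tuple RR :=
  [the n.+1.-tuple RR of x.1 :: x.2].

Lemma measurable_tuple_cons (n : nat) : measurable_fun setT (@tuple_cons n).
Proof. exact: measurable_cons. Qed.

HB.instance Definition _ (n : nat) :=
  isMeasurableFun.Build _ _ _ _ (@tuple_cons n) (@measurable_tuple_cons n).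

Section step.
Context (n : nat) (mu : {sigma_finite_measure set (n.-tuple RR) -> \bar R}).

Definition lebesgue_tupleS : set (n.+1.-tuple RR) -> \bar R :=
  pushforward (@lebesgue_measure R \x mu)%E (@tuple_cons n).

Let lebesgue_tupleS0 : lebesgue_tupleS set0 = 0%E.
Proof. exact: measure0. Qed.

Let lebesgue_tupleS_ge0 A : (0 <= lebesgue_tupleS A)%E.
Proof. exact: measure_ge0. Qed.

Let lebesgue_tupleS_sigma_additive : semi_sigma_additive lebesgue_tupleS.
Proof. exact: measure_semi_sigma_additive. Qed.

HB.instance Definition _ := isMeasure.Build _ _ _ lebesgue_tupleS
  lebesgue_tupleS0 lebesgue_tupleS_ge0 lebesgue_tupleS_sigma_additive.

Lemma sigma_finite_lebesgue_tupleS : sigma_finite setT lebesgue_tupleS.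
Proof.
have /sigma_finiteP[F [FT ndF Foo]] := sigma_finiteT (@lebesgue_measure R).
have /sigma_finiteP[G [GT ndG Goo]] := sigma_finiteT mu.
pose H k : set (n.+1.-tuple RR) :=
  (fun t : n.+1.-tuple RR => tnth t ord0) @^-1` F k `&`
  (fun t : n.+1.-tuple RR => [tuple of behead t]) @^-1` G k.
have tupleK (x : RR) (t : n.-tuple RR) :
    [tuple of behead (@tuple_cons n (x, t))] = t by exact: val_inj.
exists H => [|k].
  apply/esym; rewrite -subTset => t _.
  have [i _ Fi] : (\bigcup_i F i) (tnth t ord0) by rewrite -FT.
  have [j _ Gj] : (\bigcup_i G i) [tuple of behead t] by rewrite -GT.
  exists (maxn i j) => //; split.
    exact: (subsetPset _ _ (ndF _ _ (leq_maxl i j))).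
  exact: (subsetPset _ _ (ndG _ _ (leq_maxr i j))).
have [mF Fk] := Foo k; have [mG Gk] := Goo k; split.
  by apply: measurableI; rewrite -[X in measurable X]setTI;
    [exact: measurable_tnth|exact: measurable_behead].
rewrite /lebesgue_tupleS /pushforward (_ : _ @^-1` _ = F k `*` G k).
  by rewrite product_measure1E// lte_mul_pinfty// ge0_fin_numE.
by apply/seteqP; split=> -[x t]; rewrite /H /= tupleK.
Qed.

HB.instance Definition _ := Measure_isSigmaFinite.Build _ _ _
  lebesgue_tupleS sigma_finite_lebesgue_tupleS.

End step.

Fixpoint lebesgue_tuple (n : nat) :
    {sigma_finite_measure set (n.-tuple RR) -> \bar R} :=
  match n with
  | 0 => [the {sigma_finite_measure set (0.-tuple RR) -> \bar R}
           of dirac [tuple of [::]]]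
  | m.+1 => [the {sigma_finite_measure set (m.+1.-tuple RR) -> \bar R}
              of lebesgue_tupleS (lebesgue_tuple m)]
  end.

End lebesgue_tuple.

Lemma lebesgue_tuple_box {R : realType} (n : nat)
    (A : 'I_n -> set (measurableTypeR R)) :
  (forall i, measurable (A i)) ->
  lebesgue_tuple n [set t | forall i, A i (tnth t i)] =
  (\prod_(i < n) lebesgue_measure (A i))%E.
Proof.
elim: n A => [|n IH] A mA.
  rewrite big_ord0 /= diracE mem_set//= => -[].
  by [].
rewrite big_ord_recl -IH//= /lebesgue_tupleS /pushforward.
set B := (X in _ = (_ * (lebesgue_tuple n) X)%E).
rewrite (_ : _ @^-1` _ = A ord0 `*` B).
  rewrite product_measure1E//.
  rewrite /B (_ : [set t | _] = \bigcap_(i in [set: 'I_n])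
      (fun t : n.-tuple _ => tnth t i) @^-1` A (lift ord0 i)).
    apply: fin_bigcap_measurable => // i _.
    by rewrite -[X in measurable X]setTI; exact: measurable_tnth.
  by apply/seteqP; split => t /= At i; [move=> _|]; exact: At.
apply/seteqP; split => -[x t] /=.
  move=> At; split; first exact: (At ord0).
  by move=> i; have := At (lift ord0 i); rewrite tnthS.
move=> [/= Ax Bt] i; have [j ->|->] := unliftP ord0 i; last by [].
by rewrite tnthS; exact: Bt.
Qed.

Section lattice_discrepancy.
Context {R : realType} {d : nat}.
Implicit Types (L P C : set 'rV[R]_d) (u x : 'rV[R]_d) (T : set R).

(* $d$-dimensional Lebesgue measure in its completed form: a convex set is
   always Lebesgue measurable but need not be Borel. *)
Definition vol C : \bar R :=
  @completed_measure_extension _ _ _ (lebesgue_tuple d)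
    [set t | C (\row_i tnth t i)].

Definition integration_lattice L : Prop :=
  [/\ zmod_closed [in L],
      L `<=` isolated L &
      [set x : 'rV[R]_d | forall i, x 0 i \is a Num.int] `<=` L].

Definition lattice_points L : set 'rV[R]_d :=
  L `&` [set x : 'rV[R]_d | forall i, 0 <= x 0 i < 1].

Definition dotprod u x : R := \sum_i u 0 i * x 0 i.

Definition hyperplane u (t : R) : set 'rV[R]_d := [set x | dotprod u x = t].

(* A family of parallel hyperplanes is given by a common unit normal [u] and an
   arbitrary set [T] of offsets, not necessarily equidistant; the hyperplanes
   at offsets [s] and [t] lie at distance [`|t - s|]. *)
Definition adjacent_distances L : set R :=
  [set g | exists u T s t,
    [/\ dotprod u u = 1,
        L `<=` \bigcup_(r in T) hyperplane u r,
        T s /\ T t,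
        s < t /\ (forall r, T r -> ~~ (s < r < t)) &
        g = t - s]].

(* When [L] is an integration lattice this set is nonempty and, as [L] contains
   the canonical basis, bounded above by 1, so [sup] is a genuine supremum. *)
Definition spectral_test L : R := sup (adjacent_distances L).

(* [N] stands for the number of elements of [P]; [P] is finite in all uses, so
   [fset_set] does not fall back to its default value. *)
Definition isotropic_discrepancy (N : nat) P : \bar R :=
  ereal_sup [set `|(#|` fset_set (P `&` C)|%:R / N%:R)%:E - vol C|%E
    | C in [set C | convex_set (C : set (convex_lmodType 'rV[R]_d)) /\
                    C `<=` [set x : 'rV[R]_d | forall i, 0 <= x 0 i <= 1]]].

End lattice_discrepancy.

(* Main.v *)
Require Import Defs.
From mathcomp Require Import all_boot all_order all_algebra finmap.
From mathcomp Require Import ring lra zify.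
From mathcomp Require Import all_classical all_reals all_analysis.

(** Why the bound holds.  Put [s := spectral_test L] and [rho := 2^d s / 2].

    Every point of the space is within [rho] of [L].  A vector [u] of the dual
    lattice slices [L] into hyperplanes at distance [1 / |u|], and [1 / |u|] is
    at most [s].  When [u] is almost shortest, one walks to the nearest slice
    and continues inside the slice; the projections along [u] of the other dual
    vectors are at least half as long as [u], so the spacing of the slices at
    most doubles from one dimension to the next, and the squared distances add
    up to at most [(4^d - 1) s^2 / 12] ([nearest_plane], [covering_radius_le]).

    Let [M] be a large multiple of [N!].  The grid [(1/M) Z^d] contains [L].
    Each of the [M^d] grid points [y] of the unit cube has a lattice vector
    [l(y)] within [rho]; the copies [L + (y - l(y))] of [L], each shifted by at
    most [rho], cover every grid point exactly [N] times, once for each class of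
    [L] modulo [Z^d] ([sum_residue_slice]).  Hence, for a convex [C], the number
    of points of [L] in [C] divided by [N], the number of grid points in [C]
    divided by [M^d], and the volume of [C] (compared with the grid through
    cells of side [1/M]) differ by at most the share of the grid points that lie
    near the boundary of [C] ([grid_discrepancy]).

    These are few.  If [z] is not in the convex set [C], then one of the [2^d]
    open orthants with apex [z] misses [C] ([segment_closed_orthants]).  Fix the
    orthant.  Moving further than [a + b] along its diagonal leads from a point
    within [b] of such an apex to points that are not within [a] of [C], so a
    box of side [K] holds at most [K^d - (K - T)^d <= d T K^(d-1)] boundary
    points, [T] being the length of that move in grid steps
    ([boundary_zone_card]).  Summing over orthants and letting [a + b] be
    [rho + 1/M], the discrepancy is at most about
    [2^d d (2 rho) (1 + 3 rho)^(d-1) = d 4^d s (1 + 3 rho)^(d-1)].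

    The discrepancy never exceeds [1], so the claimed bound [d 4^(d+1) s] may be
    assumed less than [1]; then [rho] is so small that the last factor is at
    most [2]. *)

Set Implicit Arguments.
Unset Strict Implicit.
Unset Printing Implicit Defensive.
Import Order.TTheory GRing.Theory Num.Theory.
Local Open Scope classical_set_scope.
Local Open Scope card_scope.
Local Open Scope ring_scope.

(** * The scalar product *)

Section dot_product.
Context {R : realType} {d : nat}.
Implicit Types (u v w x : 'rV[R]_d) (a : R).

Lemma dotprodE u v : dotprod u v = (v *m u^T) 0 0.
Proof. by rewrite mxE; apply: eq_bigr => i _; rewrite mxE mulrC. Qed.

Lemma dotprodC u v : dotprod u v = dotprod v u.
Proof. by apply: eq_bigr => i _; rewrite mulrC. Qed.

Lemma dotprodDr u v w : dotprod u (v + w) = dotprod u v + dotprod u w.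
Proof. by rewrite !dotprodE mulmxDl mxE. Qed.

Lemma dotprodZr a u v : dotprod u (a *: v) = a * dotprod u v.
Proof. by rewrite !dotprodE -scalemxAl mxE. Qed.

Lemma dotprodBr u v w : dotprod u (v - w) = dotprod u v - dotprod u w.
Proof. by rewrite dotprodDr -scaleN1r dotprodZr mulN1r. Qed.

Lemma dotprodDl u v w : dotprod (u + v) w = dotprod u w + dotprod v w.
Proof. by rewrite dotprodC dotprodDr !(dotprodC w). Qed.

Lemma dotprodBl u v w : dotprod (u - v) w = dotprod u w - dotprod v w.
Proof. by rewrite dotprodC dotprodBr !(dotprodC w). Qed.

Lemma dotprodZl a u v : dotprod (a *: u) v = a * dotprod u v.
Proof. by rewrite dotprodC dotprodZr dotprodC. Qed.

Lemma dotprod0l v : dotprod 0 v = 0.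
Proof. by rewrite -(scale0r 0) dotprodZl mul0r. Qed.

Lemma dotprod0r v : dotprod v 0 = 0.
Proof. by rewrite dotprodC dotprod0l. Qed.

Lemma dotprod_delta u i : dotprod u (delta_mx 0 i) = u 0 i.
Proof.
rewrite /dotprod (bigD1 i)//= mxE !eqxx mulr1 big1 ?addr0// => j ji.
by rewrite mxE (negbTE ji) andbF mulr0.
Qed.

Lemma sqr_coord_le_dotprod u i : u 0 i ^+ 2 <= dotprod u u.
Proof.
rewrite /dotprod (bigD1 i)//= -expr2 lerDl sumr_ge0// => j _.
by rewrite -expr2 sqr_ge0.
Qed.

Lemma dotprod_ge0 u : 0 <= dotprod u u.
Proof. by apply: sumr_ge0 => i _; rewrite -expr2 sqr_ge0. Qed.

Lemma dotprod_gt0 u : (0 < dotprod u u) = (u != 0).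
Proof.
apply/idP/idP => [|u0]; first by apply: contraTneq => ->; rewrite dotprod0l ltxx.
rewrite lt_def dotprod_ge0 andbT; apply: contra_neq u0 => uu0.
apply/rowP => i; rewrite mxE; apply/eqP; rewrite -sqrf_eq0 eq_le sqr_ge0 andbT.
by rewrite -uu0 sqr_coord_le_dotprod.
Qed.

Lemma sub_kermx_dotprod u v : (v <= kermx u^T)%MS = (dotprod u v == 0).
Proof.
rewrite sub_kermx dotprodE; apply/eqP/eqP => [->|v0]; first by rewrite mxE.
by apply/matrixP => i j; rewrite !ord1 v0 mxE.
Qed.

End dot_product.

(** * Covering radius of a lattice with no short dual vector *)

Section covering_radius.
Context {R : realType} {d : nat}.
Implicit Types (L : set 'rV[R]_d) (u v w x : 'rV[R]_d) (V : 'M[R]_d).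

Definition dual_lattice L : set 'rV[R]_d :=
  [set w | forall l, L l -> dotprod w l \is a Num.int].

Definition additive_subgroup L := L 0 /\ forall x y, L x -> L y -> L (x - y).

Lemma subgroupN L x : additive_subgroup L -> L x -> L (- x).
Proof. by move=> [L0 LB] Lx; rewrite -sub0r; exact: LB. Qed.

Lemma subgroupD L x y : additive_subgroup L -> L x -> L y -> L (x + y).
Proof.
by move=> Lg Lx Ly; rewrite -[y]opprK; apply: Lg.2 => //; exact: subgroupN.
Qed.

Lemma subgroupMn L x n : additive_subgroup L -> L x -> L (x *+ n).
Proof.
move=> Lg Lx; elim: n => [|n IHn]; first by rewrite mulr0n; exact: Lg.1.
by rewrite mulrS; exact: subgroupD.
Qed.

Lemma subgroupMz L x (n : int) : additive_subgroup L -> L x -> L (x *~ n).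
Proof.
move=> Lg Lx; case: n => n; first by rewrite -pmulrn; exact: subgroupMn.
by rewrite NegzE mulrNz; apply: subgroupN => //; exact: subgroupMn.
Qed.

Lemma near_int (a : R) : exists n : int, `|a - n%:~R| <= 2^-1.
Proof.
exists (Num.floor (a + 2^-1)); have := floor_itv (a + 2^-1).
rewrite intrD ler_norml => /andP[]; set f := _%:~R => ? ?.
by apply/andP; split; lra.
Qed.

(** Otherwise the values of [u] on [L] are all divisible by some integer
    [g >= 2] (any one, if they all vanish), and [u / g] is a dual vector that
    is too short. *)
Lemma primitive_dual L u : additive_subgroup L -> dual_lattice L u -> u != 0 ->
  (forall w, dual_lattice L w -> w != 0 -> (exists a, w = a *: u) ->
    dotprod u u < 2 * dotprod w w) ->
  exists2 l, L l & dotprod u l = 1.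
Proof.
move=> Lg Du u0 umin; have uu0 : 0 < dotprod u u by rewrite dotprod_gt0.
have nodiv (c : R) : 2 <= c -> ~ dual_lattice L (c^-1 *: u).
  move=> c2 Dc; have c0 : c^-1 != 0 by rewrite invr_neq0// gt_eqF//; lra.
  have := umin _ Dc; rewrite scaler_eq0 negb_or c0 u0 => /(_ isT).
  move=> /(_ (ex_intro _ _ erefl)); rewrite dotprodZl dotprodZr.
  have ci : 0 <= c^-1 <= 2^-1.
    by rewrite invr_ge0 lef_pV2 ?posrE; lra.
  move: (c^-1) (dotprod u u) ci uu0 {Dc c0} => e s /andP[e0 e2] s0 lts.
  have ee : e * e <= 4^-1 by nra.
  have : (e * e) * s <= 4^-1 * s by rewrite ler_wpM2r// ltW.
  by move: lts; rewrite mulrA; lra.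
pose P n := `[< (0 < n)%N /\ exists2 l, L l & dotprod u l = n%:R >].
have exP : exists n, P n.
  apply: contrapT => noP; apply: (nodiv 2) => // l Ll.
  have /intrP[m um] := Du _ Ll; have [m0|m0] := eqVneq m 0.
    by rewrite dotprodZl um m0 mulr0.
  exfalso; apply: noP; exists `|m|%N; apply/asboolP; split.
    by rewrite absz_gt0.
  have [m_ge0|m_lt0] := leP 0 m.
    by exists l => //; rewrite um -[in LHS](gez0_abs m_ge0).
  exists (- l); first exact: subgroupN.
  rewrite -sub0r dotprodBr dotprod0r sub0r um -[m in LHS]opprK.
  by rewrite -(ltz0_abs m_lt0) mulrNz opprK.
(* g is the least positive value of u on L *)
case: (ex_minnP exP) => g /asboolP[g0 [l1 Ll1 ul1]] gmin.
have [g1|g1] := leqP g 1.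
  by exists l1 => //; rewrite ul1; have -> : g = 1%N by lia.
exfalso; apply: (nodiv g%:R); first by rewrite ler_nat.
move=> l Ll; have /intrP[m um] := Du _ Ll; rewrite dotprodZl um.
have gm : (m %% g)%Z = 0.
  have r_ge0 : (0 <= m %% g)%Z by rewrite modz_ge0//; lia.
  apply: contrapT => r0; suff /gmin : P `|(m %% g)%Z|%N.
    have : ((m %% g)%Z < g)%R by rewrite ltz_pmod//; lia.
    by lia.
  apply/asboolP; split; first by lia.
  exists (l - l1 *~ (m %/ g)%Z); first by apply: Lg.2 => //; exact: subgroupMz.
  rewrite dotprodBr -scaler_int dotprodZr ul1 um.
  rewrite [RHS](_ : _ = (m %% g)%Z%:~R); last by rewrite -[in RHS](gez0_abs r_ge0).
  by rewrite {1}(divz_eq m g) intrD intrM -pmulrn; ring.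
rewrite (divz_eq m g) gm addr0 intrM mulrCA mulVf ?mulr1 ?intr_int//.
by rewrite pnatr_eq0 -lt0n.
Qed.

(** Induction on the dimension of the span [V] of [L]: [L] is sliced by an
    almost shortest dual vector [u], and the induction hypothesis is applied to
    the slice [L'] through the origin.  A dual vector of [L'] that is
    orthogonal to [u] becomes a dual vector of [L] after subtracting [c *: u]
    with [`|c| <= 1/2], so its squared norm is at least a quarter of that of
    [u].  The bound solves [c_(r+1) = 4 c_r + 1/4].  The vector [u] is shortest
    up to a factor 2 on squared norms, which the infimum of the squared norms
    provides; the nondegeneracy hypothesis ensures that there are nonzero dual
    vectors as long as [V] is nonzero. *)
Lemma nearest_plane r V L (tau : R) :
  (\rank V <= r)%N -> additive_subgroup L -> (forall l, L l -> (l <= V)%MS) ->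
  (forall v, (v <= V)%MS -> v != 0 ->
    exists w, [/\ (w <= V)%MS, dual_lattice L w & dotprod w v != 0]) ->
  0 < tau ->
  (forall w, (w <= V)%MS -> dual_lattice L w -> w != 0 -> tau <= dotprod w w) ->
  forall x, (x <= V)%MS ->
  exists2 l, L l & dotprod (x - l) (x - l) <= (4 ^+ r - 1) / (12 * tau).
Proof.
elim: r => [|r IHr] in V L tau *.
  rewrite leqn0 mxrank_eq0 => /eqP-> Lg _ _ _ _ x; rewrite submx0 => /eqP->.
  by exists 0; rewrite ?subrr ?dotprod0l ?expr0 ?subrr ?mul0r//; case: Lg.
move=> rV Lg LV nondeg tau0 minD x xV.
have [V0|V_neq0] := eqVneq V 0.
  exists 0; [by case: Lg|]; move: xV; rewrite V0 submx0 => /eqP->.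
  by rewrite subrr dotprod0l divr_ge0 ?subr_ge0 ?exprn_ege1 ?ler1n ?mulr_ge0// ltW.
have [w0 [w0V Dw0 w00]] := nondeg (nz_row V) (nz_row_sub _)
  ltac:(by rewrite nz_row_eq0).
have {}w00 : w0 != 0 by apply: contraNneq w00 => ->; rewrite dotprod0l.
pose S := [set dotprod w w |
  w in [set w | [/\ (w <= V)%MS, dual_lattice L w & w != 0]]].
have lbS : lbound S tau by move=> _ [w [wV Dw w_neq0] <-]; exact: minD.
have infS : has_inf S.
  by split; [exists (dotprod w0 w0); exists w0|exists tau].
have inf0 : 0 < inf S by rewrite (lt_le_trans tau0)// lb_le_inf//; case: infS.
have [_ [u [uV Du u0] <-] uinf] := inf_adherent inf0 infS.
have umin w : (w <= V)%MS -> dual_lattice L w -> w != 0 ->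
    dotprod u u < 2 * dotprod w w.
  move=> wV Dw w_neq0; rewrite (lt_le_trans uinf)// mulr_natl mulr2n.
  by have := ge_inf infS.2 (ex_intro2 _ _ _ (And3 wV Dw w_neq0) erefl); lra.
have uu0 : 0 < dotprod u u by rewrite dotprod_gt0.
have [l1 Ll1 ul1] : exists2 l, L l & dotprod u l = 1.
  apply: primitive_dual => // w Dw w_neq0 [a wa]; apply: umin => //.
  by rewrite wa scalemx_sub.
(* orthogonal projection along u *)
pose proj v := v - (dotprod u v / dotprod u u) *: u.
have uproj v : dotprod u (proj v) = 0.
  by rewrite dotprodBr dotprodZr divfK ?subrr// gt_eqF.
pose V' := (V :&: kermx u^T)%MS.
have V'E v : (v <= V')%MS = (v <= V)%MS && (dotprod u v == 0).
  by rewrite sub_capmx sub_kermx_dotprod.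
have projV v : (v <= V)%MS -> (proj v <= V')%MS.
  by move=> vV; rewrite V'E uproj eqxx addmx_sub// eqmx_opp scalemx_sub.
pose L' := [set l | L l /\ dotprod u l = 0].
have L'g : additive_subgroup L'.
  split; first by split; [case: Lg|rewrite dotprod0r].
  move=> a b [La ua] [Lb ub]; split; first exact: Lg.2.
  by rewrite dotprodBr ua ub subrr.
have rV' : (\rank V' <= r)%N.
  have : (V' < V)%MS.
    rewrite ltmxE capmxSl/=; apply: contraTN uV => /(submx_trans _) H.
    by apply: contraTN uu0 => /H; rewrite V'E => /andP[_ /eqP->]; rewrite ltxx.
  by rewrite ltmxErank => /andP[_ /leq_trans/(_ rV)].
have L'V' l : L' l -> (l <= V')%MS by case=> Ll ul; rewrite V'E LV//= ul.
have nondeg' v : (v <= V')%MS -> v != 0 ->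
    exists w, [/\ (w <= V')%MS, dual_lattice L' w & dotprod w v != 0].
  rewrite V'E => /andP[vV /eqP uv] v0; have [w [wV Dw wv]] := nondeg v vV v0.
  exists (proj w); split; first exact: projV.
    move=> l [Ll ul]; rewrite dotprodBl dotprodZl ul mulr0 subr0; exact: Dw.
  by rewrite dotprodBl dotprodZl uv mulr0 subr0.
have minD' w : (w <= V')%MS -> dual_lattice L' w -> w != 0 ->
    dotprod u u / 4 <= dotprod w w.
  rewrite V'E => /andP[wV /eqP uw] Dw w_neq0.
  have [n wn] := near_int (dotprod w l1); set c := _ - _ in wn.
  have := umin (w - c *: u); rewrite addmx_sub ?eqmx_opp ?scalemx_sub//.
  have wuE : dotprod (w - c *: u) (w - c *: u) =
      dotprod w w + c ^+ 2 * dotprod u u.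
    rewrite !(dotprodBl, dotprodBr, dotprodZl, dotprodZr) uw dotprodC uw.
    by ring.
  have -> : w - c *: u != 0.
    rewrite -dotprod_gt0 wuE ltr_wpDr ?dotprod_gt0//.
    by rewrite mulr_ge0 ?sqr_ge0 ?dotprod_ge0.
  have DC : dual_lattice L (w - c *: u).
    move=> l Ll; have /intrP[k uk] := Du _ Ll.
    have L'l : L' (l - l1 *~ k).
      split; first by apply: Lg.2 => //; exact: subgroupMz.
      by rewrite dotprodBr -scaler_int dotprodZr ul1 uk mulr1 subrr.
    have -> : dotprod (w - c *: u) l = dotprod w (l - l1 *~ k) + (k * n)%:~R.
      rewrite dotprodBl dotprodZl dotprodBr -scaler_int dotprodZr uk intrM /c.
      by ring.
    by rewrite rpredD ?intr_int// Dw.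
  move=> /(_ isT DC isT); rewrite wuE.
  have : c ^+ 2 <= 4^-1.
    rewrite -real_normK ?num_real// (_ : 4^-1 = 2^-1 ^+ 2); last by field.
    by rewrite lerXn2r ?nnegrE.
  move: (c ^+ 2) (dotprod u u) (dotprod w w) uu0 => e s t; nra.
(* the slice nearest to x is the one of n l1 *)
have [n nx] := near_int (dotprod u x).
pose y := x - l1 *~ n.
have uy : dotprod u y = dotprod u x - n%:~R.
  by rewrite dotprodBr -scaler_int dotprodZr ul1 mulr1.
have yV : (y <= V)%MS.
  by rewrite addmx_sub// eqmx_opp -scaler_int scalemx_sub// LV.
have uu4 : 0 < dotprod u u / 4 by rewrite divr_gt0.
have [l' [Ll' ul'] dl'] := IHr V' L' _ rV' L'g L'V' nondeg' uu4 minD' _ (projV y yV).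
exists (l1 *~ n + l'); first by apply: subgroupD => //; exact: subgroupMz.
rewrite opprD addrA -/y; set z := proj y - l' in dl'.
have uz : dotprod u z = 0 by rewrite dotprodBr uproj ul' subrr.
have -> : y - l' = z + (dotprod u y / dotprod u u) *: u.
  by rewrite /z /proj [y - _ - l']addrAC subrK.
clearbody z y.
have -> : dotprod (z + (dotprod u y / dotprod u u) *: u)
    (z + (dotprod u y / dotprod u u) *: u) =
    dotprod z z + dotprod u y ^+ 2 / dotprod u u.
  rewrite !(dotprodDl, dotprodDr, dotprodZl, dotprodZr) (dotprodC z u) uz.
  by field; rewrite gt_eqF.
have uy4 : dotprod u y ^+ 2 <= 4^-1.
  rewrite uy -real_normK ?num_real// (_ : 4^-1 = 2^-1 ^+ 2); last by field.
  by rewrite lerXn2r ?nnegrE.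
have le4 : dotprod z z + dotprod u y ^+ 2 / dotprod u u <=
    (4 ^+ r.+1 - 1) / 12 / dotprod u u.
  have -> : (4 ^+ r.+1 - 1) / 12 / dotprod u u =
    (4 ^+ r - 1) / (12 * (dotprod u u / 4)) + 4^-1 / dotprod u u.
    by rewrite exprS; field; rewrite gt_eqF.
  by rewrite lerD// ler_pM2r// invr_gt0.
apply: (le_trans le4); rewrite invfM mulrA; apply: ler_wpM2l.
  by rewrite divr_ge0// subr_ge0 exprn_ege1// ler1n.
by rewrite lef_pV2 ?posrE// minD.
Qed.

End covering_radius.

(** * Integration lattices and their spectral test *)

Section lattice_arithmetic.
Context {R : realType} {d : nat}.
Implicit Types (L : set 'rV[R]_d) (x y : 'rV[R]_d).

Definition integer_points : set 'rV[R]_d :=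
  [set x | forall i, x 0 i \is a Num.int].

Definition frac x : 'rV[R]_d := \row_i (x 0 i - (Num.floor (x 0 i))%:~R).

Lemma frac_itv x i : 0 <= frac x 0 i < 1.
Proof.
rewrite mxE; have := floor_itv (x 0 i); rewrite intrD => /andP[].
by set f := _%:~R => ? ?; apply/andP; split; lra.
Qed.

Lemma frac_int x : integer_points (x - frac x).
Proof. by move=> i; rewrite !mxE opprB addrC subrK intr_int. Qed.

Lemma integer_unit_cube x y : (forall i, 0 <= x 0 i < 1) ->
  (forall i, 0 <= y 0 i < 1) -> integer_points (x - y) -> x = y.
Proof.
move=> x01 y01 xy; apply/rowP => i; have := xy i; rewrite !mxE => /intrP[m xyE].
have [/andP[? ?] /andP[? ?]] := (x01 i, y01 i).
suff m0 : m = 0 by apply/eqP; rewrite -subr_eq0 xyE m0.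
have : (-1)%:~R < (m%:~R : R) by rewrite -xyE; lra.
have : (m%:~R : R) < 1%:~R by rewrite -xyE; lra.
by rewrite !ltr_int; lia.
Qed.

Variable L : set 'rV[R]_d.
Hypothesis latL : integration_lattice L.

Lemma integration_lattice_subgroup : additive_subgroup L.
Proof.
case: latL => -[L0 LB] _ _; split; first by move: L0; rewrite inE.
by move=> x y Lx Ly; have := LB x y; rewrite !inE; apply.
Qed.

Lemma integration_lattice_int x : integer_points x -> L x.
Proof. by case: latL => _ _; apply. Qed.

Lemma lattice_frac x : L x -> lattice_points L (frac x).
Proof.
move=> Lx; split; last exact: frac_itv.
have -> : frac x = x - (x - frac x) by rewrite opprB addrC subrK.
by apply: integration_lattice_subgroup.2 => //; apply: integration_lattice_int;
  exact: frac_int.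
Qed.

(** The hyperplanes on which [dotprod w] is an integer cover [L], and
    neighbours are at distance [1 / |w|].  The supremum is over a bounded set:
    all multiples of a basis vector [delta_mx 0 i] with [u 0 i != 0] lie on
    hyperplanes of a given family, so no gap exceeds [`|u 0 i| <= 1]. *)
Lemma spectral_test_ge w : dual_lattice L w -> w != 0 ->
  (Num.sqrt (dotprod w w))^-1 <= spectral_test L.
Proof.
move=> Dw w0; set n := Num.sqrt _; have n0 : 0 < n by rewrite sqrtr_gt0 dotprod_gt0.
apply: ub_le_sup.
  exists 1 => _ [u [T [s [t [uu LT [Ts Tt] [st Tgap] ->]]]]].
  have [i ui0] : exists i, u 0 i != 0.
    apply: contrapT => /forallNP u0; move: uu; rewrite (_ : u = 0).
      by rewrite dotprod0l => /esym/eqP; rewrite oner_eq0.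
    by apply/rowP => i; rewrite mxE; apply/eqP; apply: contrapT => /negP/u0.
  have Tu (m : int) : T (m%:~R * u 0 i).
    have /LT[r Tr] : L (m%:~R *: delta_mx 0 i).
      apply: integration_lattice_int => k; rewrite !mxE rpredM ?intr_int//.
      exact: natr_int.
    by rewrite /hyperplane/= dotprodZr dotprod_delta => ->.
  pose a := `|u 0 i|; have a0 : 0 < a by rewrite normr_gt0.
  have a1 : a <= 1.
    rewrite -(@expr_le1 _ 2 a) ?(ltW a0)// [leLHS]real_normK ?num_real// -uu.
    exact: sqr_coord_le_dotprod.
  have Ta (m : int) : T (m%:~R * a).
    rewrite /a; have [_|_] := ger0P (u 0 i); first exact: Tu.
    by rewrite mulrN -mulNr -intrN.
  rewrite leNgt; apply/negP => st1.
  apply: (negP (Tgap _ (Ta (Num.floor (s / a) + 1)))).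
  have := floor_itv (s / a); rewrite ler_pdivlMr// ltr_pdivrMr// intrD mulrDl mul1r.
  by case/andP => ? ->/=; lra.
exists (n^-1 *: w), [set r | exists m : int, r = m%:~R / n], 0, n^-1; split.
- rewrite dotprodZl dotprodZr mulrA -invfM -expr2 sqr_sqrtr ?dotprod_ge0//.
  by rewrite mulVf// gt_eqF// dotprod_gt0.
- move=> l Ll; have /intrP[m wl] := Dw _ Ll; exists (m%:~R / n); first by exists m.
  by rewrite /hyperplane/= dotprodZl wl mulrC.
- by split; [exists 0; rewrite mul0r|exists 1; rewrite mul1r].
- split; first by rewrite invr_gt0.
  move=> _ [m ->]; rewrite -[X in _ < _ < X]mul1r ltr_pM2r ?invr_gt0//.
  rewrite pmulr_lgt0 ?invr_gt0// ltr0z (ltrz1 R); lia.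
- by rewrite subr0.
Qed.

Variable N : nat.
Hypothesis cardP : (lattice_points L #= `I_N)%card.

Lemma finite_lattice_points : finite_set (lattice_points L).
Proof. by exists N. Qed.

Lemma card_lattice_points : #|` fset_set (lattice_points L)| = N.
Proof. exact: card_fset_set. Qed.

Lemma lattice_card_gt0 : (0 < N)%N.
Proof.
rewrite -card_lattice_points cardfs_gt0; apply/fset0Pn; exists 0.
rewrite in_fset_set ?inE; last exact: finite_lattice_points.
by split => [|i]; [exact: integration_lattice_subgroup.1|rewrite mxE lexx ltr01].
Qed.

(** Pigeonhole: among the [N + 1] multiples [x *+ j], [j <= N], two have the
    same fractional part, so some [x *+ k] with [0 < k <= N] is integral. *)
Lemma fact_lattice_int x : L x -> integer_points (x *+ N`!).
Proof.
move=> Lx; have Lg := integration_lattice_subgroup.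
pose f (j : 'I_N.+1) := frac (x *+ j).
have [/injectiveP finj|/injectivePn[i [j ij fij]]] := boolP (injectiveb f).
  have : (#|` [fset f j | j : 'I_N.+1]%fset| <= N)%N.
    rewrite -[leqRHS]card_lattice_points; apply: fsubset_leq_card.
    apply/fsubsetP => _ /imfsetP[k _ ->].
    rewrite in_fset_set ?inE; last exact: finite_lattice_points.
    by apply: lattice_frac; exact: subgroupMn.
  by rewrite card_imfset//= -cardE card_ord ltnn.
wlog lt_ij : i j ij fij / (i < j)%N.
  move=> H; have [?|?|/val_inj ijE] := ltngtP i j; first exact: (H i j).
    by apply: (H j i); rewrite 1?eq_sym.
  by rewrite ijE eqxx in ij.
have xij : integer_points (x *+ (j - i)).
  have -> : x *+ (j - i) = (x *+ j - f j) - (x *+ i - f i).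
    by rewrite mulrnBr 1?ltnW// fij opprB addrA subrK.
  by move=> k; rewrite mxE rpredD//; [|rewrite mxE rpredN]; exact: frac_int.
have /dvdnP[q ->] : (j - i %| N`!)%N.
  by rewrite dvdn_fact// subn_gt0 lt_ij/= leq_subLR (leq_trans (leq_ord j))// leq_addl.
by rewrite mulnC mulrnA => k; rewrite mulmxnE rpredMn.
Qed.

End lattice_arithmetic.

Section lattice_covering.
Context {R : realType} {d : nat}.
Variables (L : set 'rV[R]_d) (N : nat).
Hypotheses (d_gt0 : (0 < d)%N) (latL : integration_lattice L).
Hypothesis cardP : (lattice_points L #= `I_N)%card.

(** These vectors make the dual lattice nondegenerate, as [nearest_plane]
    requires. *)
Lemma dual_lattice_delta i : dual_lattice L (N`!%:R *: delta_mx 0 i).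
Proof.
move=> l Ll; rewrite dotprodZl dotprodC dotprod_delta mulr_natl -mulmxnE.
exact: (fact_lattice_int latL cardP Ll i).
Qed.

Lemma fact_delta_neq0 i : N`!%:R *: delta_mx 0 i != 0 :> 'rV[R]_d.
Proof.
rewrite scaler_eq0 negb_or pnatr_eq0 -lt0n fact_gt0/=.
by apply/eqP => /rowP/(_ i)/eqP; rewrite !mxE !eqxx oner_eq0.
Qed.

Lemma spectral_test_gt0 : 0 < spectral_test L.
Proof.
have := spectral_test_ge latL (dual_lattice_delta (Ordinal d_gt0)) (fact_delta_neq0 _).
apply: lt_le_trans.
by rewrite invr_gt0 sqrtr_gt0 dotprod_gt0 fact_delta_neq0.
Qed.

Lemma covering_radius_le (x : 'rV[R]_d) :
  exists2 l, L l & forall i, `|x 0 i - l 0 i| <= 2 ^+ d * spectral_test L / 2.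
Proof.
have s0 := spectral_test_gt0; set s := spectral_test L in s0 *.
have s2 : 0 < (s ^+ 2)^-1 by rewrite invr_gt0 exprn_gt0.
have nondeg v : (v <= (1%:M : 'M[R]_d))%MS -> v != 0 -> exists w,
    [/\ (w <= (1%:M : 'M[R]_d))%MS, dual_lattice L w & dotprod w v != 0].
  move=> _ v0; have [i vi0] : exists i, v 0 i != 0.
    apply: contrapT => /forallNP vi; move/eqP: v0; apply; apply/rowP => i.
    by rewrite mxE; apply/eqP; apply: contrapT => /negP/vi.
  exists (N`!%:R *: delta_mx 0 i); split; [exact: submx1|exact: dual_lattice_delta|].
  by rewrite dotprodZl dotprodC dotprod_delta mulf_neq0// pnatr_eq0 -lt0n fact_gt0.
have minD w : (w <= (1%:M : 'M[R]_d))%MS -> dual_lattice L w -> w != 0 ->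
    (s ^+ 2)^-1 <= dotprod w w.
  move=> _ Dw w0; have := spectral_test_ge latL Dw w0; rewrite -/s.
  have ww0 : 0 < Num.sqrt (dotprod w w) by rewrite sqrtr_gt0 dotprod_gt0.
  rewrite invf_ple ?posrE// => sw; rewrite -[leRHS]sqr_sqrtr ?dotprod_ge0//.
  by rewrite -exprVn lerXn2r ?nnegrE ?invr_ge0 ?(ltW s0) ?(ltW ww0).
have [l Ll xl] := nearest_plane (rank_leq_row _) (integration_lattice_subgroup latL)
  (fun l _ => submx1 l) nondeg s2 minD (submx1 x).
exists l => // i; rewrite -(@ler_pXn2r _ 2) ?nnegrE//; last first.
  by rewrite divr_ge0 ?mulr_ge0 ?exprn_ge0// ltW.
rewrite real_normK ?num_real//; have := sqr_coord_le_dotprod (x - l) i.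
rewrite !mxE => /le_trans -> //; apply: le_trans xl _.
have -> : (2 ^+ d * s / 2) ^+ 2 = 4 ^+ d * s ^+ 2 / 4.
  have -> : 4 = 2 ^+ 2 :> R by ring.
  by rewrite -exprM mulnC exprM; field.
rewrite invfM invrK.
have : 0 < s ^+ 2 by rewrite exprn_gt0.
have : 1 <= 4 ^+ d :> R by rewrite exprn_ege1 // ler1n.
by move: (4 ^+ d) (s ^+ 2) => q t; nra.
Qed.

End lattice_covering.

(** * Orthants that miss a convex set *)

Section orthants.
Context {R : realType} {d : nat}.
Implicit Types (C : set 'rV[R]_d) (v x y z : 'rV[R]_d) (e : {ffun 'I_d -> bool}).

Definition in_orthant e v := forall i, 0 < (-1) ^+ e i * v 0 i.

Definition misses_orthant C z := exists e, forall c, C c -> ~ in_orthant e (c - z).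

Definition segment_closed C := forall x y t, C x -> C y -> 0 <= t <= 1 ->
  C (t *: x + (1 - t) *: y).

Lemma segment_closed_convex_set C :
  convex_set (C : set (convex_lmodType 'rV[R]_d)) -> segment_closed C.
Proof.
move=> Ccvx x y t Cx Cy t01.
have := Ccvx x y (Itv01 (andP t01).1 (andP t01).2).
by rewrite !inE; exact.
Qed.

(** From one point of [C] in each open orthant with apex [z], the coordinates
    of [z] are reached one at a time: two points lying on either side of [z] in
    coordinate [k], and equal to [z] in the previous ones, have a convex
    combination that agrees with [z] also in coordinate [k]. *)
Lemma segment_closed_orthants C z : segment_closed C ->
  (forall e, exists2 c, C c & in_orthant e (c - z)) -> C z.
Proof.
move=> Ccvx Corth.
suff H k : (k <= d)%N -> forall e, exists2 c, C c & forall i : 'I_d,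
    if (i < k)%N then c 0 i = z 0 i else 0 < (-1) ^+ e i * (c - z) 0 i.
  have [c Cc cz] := H d (leqnn d) [ffun=> false].
  suff <- : c = z by [].
  by apply/rowP => i; have := cz i; rewrite ltn_ord.
elim: k => [_ e|k IHk kd e]; first exact: Corth.
pose ek b : {ffun 'I_d -> bool} := [ffun i : 'I_d => if i == k :> nat then b else e i].
have [x Cx xz] := IHk (ltnW kd) (ek false).
have [y Cy yz] := IHk (ltnW kd) (ek true).
pose ko := Ordinal kd.
have xk : z 0 ko < x 0 ko.
  by have := xz ko; rewrite ltnn !ffunE eqxx expr0 mul1r !mxE subr_gt0.
have yk : y 0 ko < z 0 ko.
  by have := yz ko; rewrite ltnn !ffunE eqxx expr1 mulN1r !mxE oppr_gt0 subr_lt0.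
pose t := (z 0 ko - y 0 ko) / (x 0 ko - y 0 ko).
have xy0 : 0 < x 0 ko - y 0 ko by lra.
have t0 : 0 < t by rewrite divr_gt0// subr_gt0.
have t1 : t < 1 by rewrite ltr_pdivrMr// mul1r; lra.
exists (t *: x + (1 - t) *: y); first by apply: Ccvx => //; rewrite !ltW.
move=> i; have := (xz i, yz i); rewrite !mxE !ffunE ltnS.
have [ik|ki|ik] := ltngtP i k.
- by move=> [-> ->]; ring.
- move=> [xp yp].
  set s := (-1) ^+ e i in xp yp *.
  rewrite (_ : s * _ = t * (s * (x 0 i - z 0 i)) + (1 - t) * (s * (y 0 i - z 0 i))).
    by rewrite addr_gt0// mulr_gt0// subr_gt0.
  by ring.
- by have -> : i = ko by [exact: val_inj]; rewrite /t => _; field; rewrite gt_eqF.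
Qed.

Lemma misses_orthantP C z : segment_closed C -> ~ C z -> misses_orthant C z.
Proof.
move=> Ccvx; apply: contra_notP => /forallNP nz.
apply: segment_closed_orthants => // e.
have /existsNP[c /not_implyP[Cc /contrapT oc]] := nz e.
by exists c.
Qed.

(** The points of a lattice point set have coordinates less than [1], so a
    lattice vector can fail to be counted while lying in [C], on an upper face
    of the cube.  Such a vector still has an orthant that misses [C]: the one
    leading out of the cube. *)
Lemma misses_orthant_halfopen C z : segment_closed C ->
  C `<=` [set x | forall i, 0 <= x 0 i <= 1] ->
  ~ (C z /\ forall i, 0 <= z 0 i < 1) -> misses_orthant C z.
Proof.
move=> Ccvx C01 nCz; have [Cz|] := pselect (C z); last exact: misses_orthantP.
exists [ffun=> false] => c Cc oc; apply: nCz; split=> // i.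
have /andP[-> z1]/= := C01 _ Cz i; have /andP[_ c1] := C01 _ Cc i.
by have := oc i; rewrite ffunE expr0 mul1r !mxE; lra.
Qed.

End orthants.

(** * Grid points near the boundary of a convex set *)

Section grid.
Context {R : realType} {d : nat}.
Variables M J K : nat.
Hypothesis M_gt0 : (0 < M)%N.
Notation G := {ffun 'I_d -> 'I_K}.
Implicit Types (g : G) (C : set 'rV[R]_d).

(** The grid [(1/M) Z^d], restricted to the box of side [K/M] whose lowest
    corner has all coordinates equal to [- J/M]; the margin [J] leaves room for
    points slightly outside the unit cube. *)
Definition gridpt g : 'rV[R]_d := \row_i (((g i)%:R - J%:R) / M%:R).

(** The point [z] stands for a point outside [C].  Keeping, instead of
    [~ C z], the orthant that misses [C] allows [z] to be a point of [C] on an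
    upper face of the cube. *)
Definition boundary_zone C (a b : R) : {set G} :=
  finset (fun g : G => `[< exists c z, [/\ C c, misses_orthant C z,
    (forall i, `|gridpt g 0 i - c 0 i| <= a) &
    (forall i, `|gridpt g 0 i - z 0 i| <= b)] >]).

(** Here [e] is the direction of a diagonal move of length [T].  Pairs
    [(w, w + T e)] inside the box correspond to points [w] of a box of side
    [K - T].  If the first point is in [O], the second is in [O :\: B];
    otherwise the first is outside [O].  So the [(K - T) ^ d] pairs embed in
    the complement of [B]. *)
Lemma diagonal_sparse_card (T : nat) (e : 'I_d -> bool) (B O : {set G}) :
  B \subset O ->
  (forall g g' : G, g \in O -> (forall i, if e i then g i = g' i + T :> nat
      else g i + T = g' i :> nat)%N -> g' \in O :\: B) ->
  (#|B| + (K - T) ^ d <= K ^ d)%N.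
Proof.
move=> BO Oshift.
have ltK (b : bool) (w : 'I_(K - T)) : (w + b * T < K)%N.
  have := ltn_ord w; rewrite ltn_subRL => wT.
  by rewrite (leq_ltn_trans _ wT)// addnC leq_add2r; case: b => //; rewrite mul1n.
pose shift (f : 'I_d -> bool) (w : {ffun 'I_d -> 'I_(K - T)}) : G :=
  [ffun i => Ordinal (ltK (f i) (w i))].
have shift_inj f : injective (shift f).
  move=> w w' /ffunP ww'; apply/ffunP => i; have := ww' i; rewrite !ffunE.
  by move=> /(congr1 val)/addIn/val_inj.
pose A := finset (fun w => shift e w \in O).
have cA : (#|A| <= #|O :\: B|)%N.
  rewrite -(card_imset _ (shift_inj (fun i => ~~ e i))); apply: subset_leq_card.
  apply/fintype.subsetP => _ /imsetP[w wA ->]; rewrite inE in wA.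
  apply: Oshift wA _ => i.
  by rewrite !ffunE/=; case: (e i); rewrite /= mul0n mul1n addn0.
have cA' : (#|~: A| <= #|~: O|)%N.
  rewrite -(card_imset _ (shift_inj e)); apply: subset_leq_card.
  by apply/fintype.subsetP => _ /imsetP[w wA ->]; rewrite !inE in wA *.
have : (#|A| + #|~: A| <= #|O :\: B| + #|~: O|)%N by exact: leq_add.
rewrite cardsC card_ffun !card_ord => le1.
have : (#|O| + #|~: O| = K ^ d)%N by rewrite cardsC card_ffun !card_ord.
rewrite -[in #|O|](setID O B) (finset.setIidPr BO) cardsU.
have -> : B :&: (O :\: B) = finset.set0.
  by apply/setP => x; rewrite !inE; case: (x \in B); rewrite ?andbF.
by rewrite cards0; lia.
Qed.

Lemma bernoulli_nat (n T : nat) : (K ^ n <= (K - T) ^ n + n * (T * K ^ n.-1))%N.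
Proof.
elim: n => [//|[|n] IHn]; first by rewrite !expn1 expn0; lia.
have le : ((K - T) ^ n.+1 <= K ^ n.+1)%N by rewrite leq_exp2r// leq_subr.
have KT : (K <= (K - T) + T)%N by lia.
move: IHn; rewrite (expnS K n.+1) (expnS (K - T) n.+1) /=.
rewrite (_ : K ^ n.+1 = K * K ^ n)%N ?expnS// in le *.
move: ((K - T) ^ n.+1)%N (K ^ n)%N le => p q le IHn.
nia.
Qed.

(** For a fixed orthant direction [e], [O e] collects the points within [b] of
    an apex whose orthant misses [C]; it is stable under diagonal moves in
    direction [e].  A move longer than [a + b] brings such a point so deep into
    the orthant that no point of [C] is left within [a] of it. *)
Lemma boundary_zone_card C (a b : R) (T : nat) : M%:R * (a + b) < T%:R ->
  (#|boundary_zone C a b| <= 2 ^ d * (d * (T * K ^ d.-1)))%N.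
Proof.
move=> abT; have M0 : 0 < M%:R :> R by rewrite ltr0n.
pose O e := finset (fun g : G => `[< exists2 z,
  (forall c, C c -> ~ in_orthant e (c - z)) &
  forall i, `|gridpt g 0 i - z 0 i| <= b >]).
pose B e := O e :&: finset (fun g : G => `[< exists2 c,
  C c & forall i, `|gridpt g 0 i - c 0 i| <= a >]).
have -> : boundary_zone C a b = (\bigcup_(e : {ffun 'I_d -> bool}) B e)%SET.
  apply/setP => g; rewrite inE; apply/asboolP/finset.bigcupP.
    move=> [c [z [Cc [e ez] gc gz]]]; exists e => //.
    by rewrite !inE; apply/andP; split; apply/asboolP; [exists z|exists c].
  move=> [e _]; rewrite !inE => /andP[/asboolP[z ez gz] /asboolP[c Cc gc]].
  by exists c, z; split=> //; exists e.
have cB e : (#|B e| <= d * (T * K ^ d.-1))%N.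
  suff : (#|B e| + (K - T) ^ d <= K ^ d)%N by have := bernoulli_nat d T; lia.
  apply: (@diagonal_sparse_card T e (B e) (O e)); first exact: subsetIl.
  move=> g g' gO gg'; rewrite !inE in gO *; case: gO => z zC gz.
  have ptgg' i : gridpt g' 0 i = gridpt g 0 i + (-1) ^+ e i * (T%:R / M%:R).
    rewrite !mxE; have := gg' i; case: (e i) => gi; rewrite ?expr1 ?expr0.
      by rewrite gi natrD; field; rewrite gt_eqF.
    by rewrite -gi natrD; field; rewrite gt_eqF.
  apply/andP; split.
    rewrite negb_and; apply/orP; right; apply/asboolPn => -[c Cc g'c].
    apply: (zC c Cc) => i; have := g'c i; have := gz i; rewrite ptgg' !mxE.
    have : a + b < T%:R / M%:R by rewrite ltr_pdivlMr// mulrC.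
    move: (T%:R / M%:R) (((g i)%:R - J%:R) / M%:R) => s p sab.
    by rewrite !ler_norml; case: (e i); rewrite ?expr1 ?expr0; lra.
  apply/asboolP; exists (z + \row_i ((-1) ^+ e i * (T%:R / M%:R))).
    move=> c Cc oc; apply: (zC c Cc) => i; have := oc i; rewrite !mxE.
    have : 0 <= T%:R / M%:R :> R by rewrite divr_ge0.
    by move: (T%:R / M%:R) => s; case: (e i); rewrite ?expr1 ?expr0; lra.
  move=> i; have := gz i; rewrite ptgg' !mxE; congr (`|_| <= _); ring.
have cU : (#|(\bigcup_e B e)%SET| <= \sum_e #|B e|)%N.
  elim/big_rec2: _ => [|e n A _ le]; first by rewrite cards0.
  by rewrite (leq_trans (leq_card_setU _ _))// leq_add2l.
apply: (leq_trans cU).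
apply: (@leq_trans (\sum_(e : {ffun 'I_d -> bool}) d * (T * K ^ d.-1))%N).
  by apply: leq_sum => e _; exact: cB.
by rewrite sum_nat_const card_ffun card_bool card_ord.
Qed.

End grid.

(** * Volume of unions of grid cells *)

Section volume.
Context {R : realType} {d : nat}.
Implicit Types (A C : set 'rV[R]_d).
Notation RR := (measurableTypeR R).

Definition tuple_set A : set (d.-tuple RR) := [set t | A (\row_i tnth t i)].

(** [vol] is an outer measure, hence monotone on all sets, so that a convex
    set is compared with boxes without any measurability argument. *)
Lemma vol_le_measurable A C : measurable (tuple_set A) -> C `<=` A ->
  (vol C <= lebesgue_tuple d (tuple_set A))%E.
Proof.
move=> mA CA; rewrite -measurable_mu_extE//.
by apply: le_mu_ext => t; exact: CA.
Qed.

Lemma vol_ge_measurable A C : measurable (tuple_set A) -> A `<=` C ->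
  (lebesgue_tuple d (tuple_set A) <= vol C)%E.
Proof.
move=> mA AC; rewrite -measurable_mu_extE//.
by apply: le_mu_ext => t; exact: AC.
Qed.

Lemma tuple_set_box (I : 'I_d -> interval R) :
  tuple_set [set x | forall i, x 0 i \in I i] =
  [set t | forall i, [set` I i] (tnth t i)].
Proof. by apply/seteqP; split=> t tI i; have := tI i; rewrite /= mxE. Qed.

Lemma measurable_box (I : 'I_d -> interval R) :
  measurable (tuple_set [set x | forall i, x 0 i \in I i]).
Proof.
rewrite tuple_set_box (_ : [set t | _] = \bigcap_(i in [set: 'I_d])
    (fun t : d.-tuple RR => tnth t i) @^-1` [set` I i]).
  apply: fin_bigcap_measurable => // i _.
  by rewrite -[X in measurable X]setTI; exact: measurable_tnth.
by apply/seteqP; split => t /= At i; [move=> _|]; exact: At.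
Qed.

Lemma lebesgue_tuple_interval_box (I : 'I_d -> interval R) :
  lebesgue_tuple d (tuple_set [set x | forall i, x 0 i \in I i]) =
  (\prod_(i < d) lebesgue_measure [set` I i])%E.
Proof.
rewrite tuple_set_box; apply: (lebesgue_tuple_box (A := fun i => [set` I i])).
by move=> i; exact: measurable_itv.
Qed.

Lemma vol_ge0 C : (0 <= vol C)%E.
Proof. exact: mu_ext_ge0. Qed.

Lemma vol_unit_cube_le1 C : C `<=` [set x | forall i, 0 <= x 0 i <= 1] ->
  (vol C <= 1)%E.
Proof.
move=> C01; pose I (i : 'I_d) : interval R := `[0, 1].
apply: (le_trans (vol_le_measurable (measurable_box I) _)).
  by move=> x /C01 x01 i; rewrite /I in_itv/=.
rewrite lebesgue_tuple_interval_box.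
rewrite big1// => i _; rewrite lebesgue_measure_itv/= lte_fin ltr01.
by rewrite oppr0 adde0.
Qed.

Variables M J K : nat.
Hypothesis M_gt0 : (0 < M)%N.
Notation G := {ffun 'I_d -> 'I_K}.
Implicit Types (g : G) (E : {set G}).
Local Notation pt := (@gridpt R d M J K).

Definition cell g : set 'rV[R]_d :=
  [set x | forall i, x 0 i \in `[pt g 0 i, pt g 0 i + M%:R^-1[].

Lemma vol_cell g :
  lebesgue_tuple d (tuple_set (cell g)) = (M%:R^-1 ^+ d)%:E.
Proof.
rewrite lebesgue_tuple_interval_box.
rewrite (eq_bigr (fun=> (M%:R^-1)%:E)) => [|i _].
  by rewrite prodEFin prodr_const card_ord.
rewrite lebesgue_measure_itv/= lte_fin ltrDl invr_gt0 ltr0n M_gt0.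
by rewrite -EFinB addrAC subrr add0r.
Qed.

Lemma cell_inj g g' x : cell g x -> cell g' x -> g = g'.
Proof.
move=> gx g'x; apply/ffunP => i; apply/val_inj.
have M0 : 0 < M%:R :> R by rewrite ltr0n.
have := (gx i, g'x i); rewrite !in_itv/= !mxE.
have MD (n : R) : n / M%:R + M%:R^-1 = (n + 1) / M%:R by rewrite mulrDl mul1r.
rewrite !MD !ler_pdivrMr// !ltr_pdivlMr//.
move=> [/andP[? ?] /andP[? ?]].
have : (g i)%:R < (g' i)%:R + 1 :> R by lra.
have : (g' i)%:R < (g i)%:R + 1 :> R by lra.
by rewrite !natr1 !ltr_nat; lia.
Qed.

Definition cells E : set 'rV[R]_d := \bigcup_(g in [set` E]) cell g.

Lemma tuple_set_cells E :
  tuple_set (cells E) = \bigcup_(g in [set` E]) tuple_set (cell g).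
Proof. by []. Qed.

Lemma measurable_cells E : measurable (tuple_set (cells E)).
Proof.
rewrite tuple_set_cells; apply: fin_bigcup_measurable => // g _.
exact: measurable_box.
Qed.

Lemma vol_cells E :
  lebesgue_tuple d (tuple_set (cells E)) = (#|E|%:R / M%:R ^+ d)%:E.
Proof.
rewrite tuple_set_cells measure_fin_bigcup//; last 2 first.
- by move=> g g' _ _ [t [gt g't]]; exact: cell_inj gt g't.
- by move=> g _; exact: measurable_box.
rewrite (eq_fsbigr (fun=> (M%:R^-1 ^+ d)%:E)) => [|g _]; last exact: vol_cell.
have -> : [set` E] = [set` enum E] by apply/seteqP; split=> g /=; rewrite mem_enum.
rewrite -fsbig_seq ?enum_uniq// big_enum/= sumEFin sumr_const.
by rewrite exprVn mulr_natl.
Qed.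

Lemma vol_le_cells C E : (forall x, C x -> exists2 g, g \in E & cell g x) ->
  (vol C <= (#|E|%:R / M%:R ^+ d)%:E)%E.
Proof.
by move=> CE; rewrite -vol_cells; exact: (vol_le_measurable (measurable_cells E)).
Qed.

Lemma vol_ge_cells C E : (forall g, g \in E -> cell g `<=` C) ->
  ((#|E|%:R / M%:R ^+ d)%:E <= vol C)%E.
Proof.
move=> EC; rewrite -vol_cells; apply: (vol_ge_measurable (measurable_cells E)).
by move=> x [g gE]; exact: EC.
Qed.

End volume.

(** * Counting lattice points through a finer grid *)

Section fine_grid.
Context {R : realType} {d : nat}.
Variable M : nat.
Hypothesis M_gt0 : (0 < M)%N.
Implicit Types x : 'rV[R]_d.

Let M0 : 0 < M%:R :> R. Proof. by rewrite ltr0n. Qed.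

Definition fine_grid : set 'rV[R]_d := [set x | integer_points (x *+ M)].

Lemma fine_gridB x x' : fine_grid x -> fine_grid x' -> fine_grid (x - x').
Proof. by move=> fx fx' i; rewrite mulrnBl !mxE rpredB. Qed.

Lemma fine_grid_gridpt J' K' (g : {ffun 'I_d -> 'I_K'}) :
  fine_grid (@gridpt R d M J' K' g).
Proof.
move=> i; rewrite mulmxnE mxE -[_ *+ M]mulr_natr divfK ?gt_eqF//.
by rewrite rpredB// natr_int.
Qed.

Lemma gridpt_inj J' K' : injective (@gridpt R d M J' K').
Proof.
move=> g g' /rowP gg'; apply/ffunP => i; apply/val_inj.
have := gg' i; rewrite !mxE => /(mulIf _)/addIr/eqP; rewrite invr_eq0 gt_eqF//.
by move=> /(_ isT); rewrite eqr_nat => /eqP.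
Qed.

Lemma fine_grid_index J' K' x : fine_grid x ->
  (forall i, - J'%:R <= x 0 i * M%:R < K'%:R - J'%:R) ->
  exists g : {ffun 'I_d -> 'I_K'}, gridpt M J' g = x.
Proof.
move=> fx xJK.
have ex i : exists n : 'I_K', x 0 i * M%:R = n%:R - J'%:R.
  have /intrP[m xm] := fx i; move: xm; rewrite mulmxnE -[_ *+ M]mulr_natr => xm.
  have /andP[] := xJK i; rewrite xm => mJ mK.
  have : (0 : int)%:~R <= (m + J'%:Z)%:~R :> R by rewrite intrD -pmulrn; lra.
  have : (m + J'%:Z)%:~R < (K'%:Z)%:~R :> R by rewrite intrD -!pmulrn; lra.
  rewrite ltr_int ler_int => mK' mJ'.
  have nK : (`|(m + J'%:Z)%R|%N < K')%N by lia.
  exists (Ordinal nK); rewrite /= -[_%:R in RHS]/(_%:Z%:~R) gez0_abs//.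
  by rewrite intrD -pmulrn addrK.
have [f fE] := boolp.choice ex; exists [ffun i => f i]; apply/rowP => i.
by rewrite mxE ffunE -fE mulfK// gt_eqF.
Qed.

End fine_grid.

Section lattice_counting.
Context {R : realType} {d : nat}.
Variables (L : set 'rV[R]_d) (N : nat).
Hypotheses (latL : integration_lattice L).
Hypothesis cardP : (lattice_points L #= `I_N)%card.
Variables M J : nat.
Hypotheses (M_gt0 : (0 < M)%N) (dvdM : (N`! %| M)%N).
Let K := (M + 2 * J)%N.
Notation G := {ffun 'I_d -> 'I_K}.
Notation Y := {ffun 'I_d -> 'I_M}.
Implicit Types (g : G) (y : Y) (x : 'rV[R]_d) (A : {set G}) (C : set 'rV[R]_d).
Local Notation pt := (@gridpt R d M J K).
Local Notation pt0 := (@gridpt R d M 0 M).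
Local Notation fine_grid := (@fine_grid R d M).

Let M0 : 0 < M%:R :> R. Proof. by rewrite ltr0n. Qed.

Lemma fine_grid_lattice x : L x -> fine_grid x.
Proof.
move=> Lx i; have [q ->] := dvdnP dvdM; rewrite mulnC mulrnA.
by rewrite mulmxnE rpredMn//; exact: (fact_lattice_int latL cardP Lx).
Qed.

Lemma fine_grid_int x : integer_points x -> fine_grid x.
Proof. by move=> ix; apply: fine_grid_lattice; exact: integration_lattice_int. Qed.

Definition coset_residues x : {set Y} := finset (fun y => `[< L (x - pt0 y) >]).

Lemma pt0_itv y i : 0 <= pt0 y 0 i < 1.
Proof.
rewrite mxE subr0 divr_ge0//= ltr_pdivrMr// mul1r ltr_nat; exact: ltn_ord.
Qed.

(** The map [y |-> frac (x - y)] is a bijection onto the lattice points of the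
    unit cube. *)
Lemma card_coset_residues x : fine_grid x -> #|coset_residues x| = N.
Proof.
move=> fx; have Lg := integration_lattice_subgroup latL.
have Lint z := @integration_lattice_int _ _ _ latL z.
have finP := finite_lattice_points cardP.
pose f y := frac (x - pt0 y).
have finj : injective f.
  move=> y y' ff'; apply: (@gridpt_inj R d M M_gt0 0 M).
  apply: integer_unit_cube => [||i].
  - exact: pt0_itv.
  - exact: pt0_itv.
  - have -> : pt0 y - pt0 y' = (x - pt0 y' - f y') - (x - pt0 y - f y).
      rewrite ff'; move: (f y') (pt0 y) (pt0 y') => a b c.
      by apply/rowP => k; rewrite !mxE; ring.
    by rewrite mxE rpredD//; [|rewrite mxE rpredN]; exact: frac_int.
rewrite -[RHS](card_lattice_points cardP).
have -> : fset_set (lattice_points L) =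
    [fset f y | y in enum (coset_residues x)]%fset.
  apply/fsetP => p; rewrite in_fset_set//; apply/idP/idP.
    rewrite inE => -[Lp p01].
    have [y yE] : exists y, pt0 y = frac (x - p).
      apply: (fine_grid_index M_gt0).
        have -> : frac (x - p) = (x - p) - (x - p - frac (x - p)).
          by rewrite subKr.
        apply: fine_gridB; first by apply: fine_gridB => //; exact: fine_grid_lattice.
        by apply: fine_grid_int; exact: frac_int.
      move=> i; have /andP[f0 f1] := frac_itv (x - p) i.
      by rewrite mulr0n oppr0 addr0 mulr_ge0//= -[ltRHS]mul1r ltr_pM2r.
    have xyp : integer_points (x - pt0 y - p).
      by rewrite yE addrAC; exact: frac_int.
    have xy : L (x - pt0 y).
      by rewrite -(subrK p (x - pt0 y)); apply: subgroupD => //; exact: Lint.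
    apply/imfsetP; exists y; first by rewrite /= mem_enum inE; apply/asboolP.
    apply: integer_unit_cube => // [i|i]; first exact: frac_itv.
    have -> : p - f y = (x - pt0 y - f y) - (x - pt0 y - p).
      move: (f y) (pt0 y) => a b; apply/rowP => k; rewrite !mxE; ring.
    by rewrite mxE rpredD//; [exact: frac_int|rewrite mxE rpredN].
  move=> /imfsetP[y /=]; rewrite mem_enum !inE => Ly ->.
  exact: (lattice_frac latL).
by rewrite card_imfset//= cardE undup_id ?enum_uniq.
Qed.

(** The grid points of [A] covered by the copy of [L] shifted by [y]. *)
Definition residue_slice A y : {set G} :=
  finset (fun g => (g \in A) && `[< L (pt g - pt0 y) >]).

Lemma sum_residue_slice A : (\sum_y #|residue_slice A y| = #|A| * N)%N.
Proof.
transitivity (\sum_(g in A) #|coset_residues (pt g)|)%N; last first.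
  rewrite -sum_nat_const; apply: eq_bigr => g _.
  by apply: card_coset_residues; exact: fine_grid_gridpt.
under eq_bigr do rewrite -sum1_card.
under [RHS]eq_bigr do rewrite -sum1_card.
rewrite (exchange_big_dep (mem A))/=; last first.
  by move=> y g _; rewrite inE => /andP[].
apply: eq_bigr => g gA; apply: eq_bigl => y; rewrite !inE gA//.
Qed.

Variable rho : R.
Hypothesis rhoP : forall x, exists2 l, L l & forall i, `|x 0 i - l 0 i| <= rho.
Hypothesis rhoJ : rho * M%:R <= J%:R.

(** For each [y], shifting [L] by the short vector [pt0 y - l] instead of [y]
    gives the same copy of [L] and moves every lattice point of [C] into [A]. *)
Lemma lattice_count_le A C :
  (forall g c, C c -> (forall i, `|pt g 0 i - c 0 i| <= rho) -> g \in A) ->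
  (M ^ d * #|` fset_set (lattice_points L `&` C)| <= #|A| * N)%N.
Proof.
move=> CA; rewrite -sum_residue_slice.
rewrite -[X in (X ^ _)%N](card_ord M) -[X in (_ ^ X)%N](card_ord d) -card_ffun.
rewrite -sum_nat_const; apply: leq_sum => y _.
have Lg := integration_lattice_subgroup latL.
have [l Ll yl] := rhoP (pt0 y).
pose shift g : 'rV[R]_d := pt g - (pt0 y - l).
apply: (@leq_trans #|` [fset shift g | g in enum (residue_slice A y)]%fset|); last first.
  by rewrite (leq_trans (leq_imfset_card _ _ _))//= cardE size_undup.
apply: fsubset_leq_card; apply/fsubsetP => p.
rewrite in_fset_set; last exact/finite_setIl/(finite_lattice_points cardP).
rewrite inE => -[[Lp p01] Cp].
have [g gE] : exists g, pt g = p + (pt0 y - l).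
  apply: (fine_grid_index M_gt0).
    rewrite -[pt0 y - l]opprB; apply: fine_gridB; first exact: fine_grid_lattice.
    by apply: fine_gridB; [exact: fine_grid_lattice|exact: fine_grid_gridpt].
  move=> i; have /andP[p0 p1] := p01 i.
  have := yl i; rewrite ler_norml => /andP[yl1 yl2].
  rewrite mxE [(pt0 y - l) 0 i]mxE [(- l) 0 i]mxE.
  have -> : K%:R - J%:R = M%:R + J%:R :> R by rewrite /K natrD natrM; ring.
  move: (pt0 y 0 i - l 0 i) yl1 yl2 => s s1 s2.
  have h1 : s * M%:R <= rho * M%:R by rewrite ler_wpM2r// ltW.
  have h2 : - rho * M%:R <= s * M%:R by rewrite ler_wpM2r// ltW.
  have h3 : 0 <= p 0 i * M%:R by rewrite mulr_ge0// ltW.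
  have h4 : p 0 i * M%:R < M%:R by rewrite -[ltRHS]mul1r ltr_pM2r.
  rewrite mulNr in h2; rewrite mulrDl; move: rhoJ h1 h2 h3 h4.
  move: (rho * _) (s * _) (p 0 i * _) => a b c.
  by move=> ? ? ? ? ?; apply/andP; split; lra.
apply/imfsetP; exists g; last by rewrite /shift gE addrK.
rewrite /= mem_enum inE; apply/andP; split.
  apply: (CA g p Cp) => i; rewrite gE; have := yl i.
  by rewrite !mxE; congr (`|_| <= _); ring.
apply/asboolP; have -> : pt g - pt0 y = p - l.
  by rewrite gE; apply/rowP => i; rewrite !mxE; ring.
exact: Lg.2.
Qed.

(** The converse move: each point of [A] in the copy of [L] shifted by [y] is
    sent to a lattice point of [C] at distance at most [rho]. *)
Lemma lattice_count_ge A C :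
  (forall g (l : 'rV[R]_d), g \in A -> (forall i, `|pt g 0 i - l 0 i| <= rho) ->
     C l /\ forall i, 0 <= l 0 i < 1) ->
  (#|A| * N <= M ^ d * #|` fset_set (lattice_points L `&` C)|)%N.
Proof.
move=> AC; rewrite -sum_residue_slice.
rewrite -[X in (X ^ _)%N](card_ord M) -[X in (_ ^ X)%N](card_ord d) -card_ffun.
rewrite -sum_nat_const; apply: leq_sum => y _.
have [l Ll yl] := rhoP (pt0 y).
pose shift g : 'rV[R]_d := pt g - (pt0 y - l).
have shift_inj : injective shift by move=> g g' /addIr/(gridpt_inj M_gt0).
apply: (@leq_trans #|` [fset shift g | g in enum (residue_slice A y)]%fset|).
  by rewrite card_imfset//= undup_id ?enum_uniq// cardE.
apply: fsubset_leq_card; apply/fsubsetP => p /imfsetP[g /=].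
rewrite mem_enum inE => /andP[gA /asboolP Lgy] ->{p}.
rewrite in_fset_set; last exact/finite_setIl/(finite_lattice_points cardP).
have [Cg g01] : C (shift g) /\ forall i, 0 <= shift g 0 i < 1.
  apply: AC gA _ => i; have := yl i; rewrite !mxE.
  by congr (`|_| <= _); ring.
rewrite inE; split => //; split=> //.
have -> : shift g = (pt g - pt0 y) + l by rewrite /shift opprB addrAC addrA.
by apply: subgroupD => //; exact: integration_lattice_subgroup.
Qed.

End lattice_counting.

(** * Discrepancy of a single convex set *)

Section grid_discrepancy.
Context {R : realType} {d : nat}.
Variables (L : set 'rV[R]_d) (N : nat).
Hypotheses (latL : integration_lattice L).
Hypothesis cardP : (lattice_points L #= `I_N)%card.
Variables M J : nat.
Hypotheses (M_gt0 : (0 < M)%N) (J_gt0 : (0 < J)%N) (dvdM : (N`! %| M)%N).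
Variable rho : R.
Hypothesis rhoP : forall x : 'rV[R]_d,
  exists2 l, L l & forall i, `|x 0 i - l 0 i| <= rho.
Hypothesis rhoJ : rho * M%:R <= J%:R.
Variable C : set 'rV[R]_d.
Hypothesis Ccvx : segment_closed C.
Hypothesis C01 : C `<=` [set x | forall i, 0 <= x 0 i <= 1].
Let K := (M + 2 * J)%N.
Notation G := {ffun 'I_d -> 'I_K}.
Implicit Types (g : G) (A : {set G}) (x : 'rV[R]_d).
Local Notation pt := (@gridpt R d M J K).
Local Notation cell := (@cell R d M J K).
Local Notation delta := (M%:R^-1 : R).

Let M0 : 0 < M%:R :> R. Proof. by rewrite ltr0n. Qed.

Definition meeting_cells : {set G} :=
  finset (fun g => `[< exists2 x, C x & cell g x >]).

Definition inner_cells : {set G} := finset (fun g => `[< cell g `<=` C >]).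

Lemma cell_near g x : cell g x -> forall i, `|pt g 0 i - x 0 i| <= delta.
Proof.
move=> gx i; have := gx i; rewrite in_itv/= ler_norml => /andP[? ?].
by apply/andP; split; lra.
Qed.

Lemma cell_cover x : C x -> exists2 g, g \in meeting_cells & cell g x.
Proof.
move=> Cx; pose x' : 'rV[R]_d := \row_i ((Num.floor (x 0 i * M%:R))%:~R / M%:R).
have x'M i : x' 0 i * M%:R = (Num.floor (x 0 i * M%:R))%:~R.
  by rewrite mxE divfK// gt_eqF.
have [g gx'] : exists g, pt g = x'.
  apply: (fine_grid_index M_gt0) => //.
    by move=> i; rewrite mulmxnE -[_ *+ M]mulr_natr x'M intr_int.
  move=> i; have /andP[x0 x1] := C01 Cx i; rewrite x'M.
  have -> : K%:R - J%:R = M%:R + J%:R :> R by rewrite /K natrD natrM; ring.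
  have J0 : 0 < J%:R :> R by rewrite ltr0n.
  have f0 : 0 <= (Num.floor (x 0 i * M%:R))%:~R :> R.
    by rewrite ler0z floor_ge0 mulr_ge0// ltW.
  have f1 : (Num.floor (x 0 i * M%:R))%:~R <= M%:R :> R.
    apply: le_trans (floor_le _) _; rewrite -[leRHS]mul1r ler_wpM2r// ltW//.
  by apply/andP; split; lra.
have gx : cell g x.
  move=> i; rewrite in_itv/= gx' mxE.
  have /andP[f0 f1] := floor_itv (x 0 i * M%:R).
  have -> : (Num.floor (x 0 i * M%:R))%:~R / M%:R + M%:R^-1 =
      (Num.floor (x 0 i * M%:R) + 1)%:~R / M%:R :> R.
    by rewrite intrD mulrDl mul1r.
  by rewrite ler_pdivrMr// f0 ltr_pdivlMr.
by exists g => //; rewrite inE; apply/asboolP; exists x.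
Qed.

(** A grid point within [rho] of a point of [C] has its cell inside [C] unless
    a point of the cell lies outside [C], at distance at most [1/M]. *)
Lemma inner_cells_count :
  (M ^ d * #|` fset_set (lattice_points L `&` C)| <=
   (#|inner_cells| + #|boundary_zone M J K C rho delta|) * N)%N.
Proof.
apply: leq_trans (leq_mul (leq_card_setU inner_cells
  (boundary_zone M J K C rho delta)).1 (leqnn N)).
apply: (lattice_count_le latL cardP M_gt0 dvdM rhoP rhoJ) => g c Cc gc.
rewrite finset.in_setU orbC; have [gC|] := pselect (cell g `<=` C).
  by apply/orP; right; rewrite inE; apply/asboolP.
move=> /existsNP[z /not_implyP[gz nCz]]; apply/orP; left.
rewrite inE; apply/asboolP; exists c, z; split => //.
  exact: misses_orthantP.
exact: cell_near.
Qed.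

(** Conversely, a grid point whose cell meets [C] has all lattice points within
    [rho] counted in [C], unless it lies in the boundary zone. *)
Lemma meeting_cells_count :
  (#|meeting_cells| * N <= M ^ d * #|` fset_set (lattice_points L `&` C)| +
    #|boundary_zone M J K C delta rho| * N)%N.
Proof.
pose B := boundary_zone M J K C delta rho.
apply: (@leq_trans ((#|meeting_cells :\: B| + #|B|) * N)%N).
  rewrite leq_mul2r; apply/orP; right; rewrite -(cardsID B meeting_cells) addnC.
  by rewrite leq_add2l subset_leq_card// subsetIr.
rewrite mulnDl leq_add2r.
apply: (lattice_count_ge latL cardP M_gt0 dvdM rhoP) => g l gA gl.
move: gA; rewrite !inE => /andP[nB /asboolP[x Cx gx]].
apply: contrapT => nCl; move/negP: nB; apply; apply/asboolP.
exists x, l; split => //; last exact: cell_near.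
exact: misses_orthant_halfopen nCl.
Qed.

Lemma grid_discrepancy :
  (`|(#|` fset_set (lattice_points L `&` C)|%:R / N%:R)%:E - vol C| <=
   ((2 ^ d * (d * ((J + 2) * K ^ d.-1)))%:R / M%:R ^+ d)%:E)%E.
Proof.
set Z := (2 ^ d * _)%N; set n := #|` _|.
(* a diagonal move of J + 2 grid steps is longer than rho + 1/M *)
have JT a b : a + b = rho + delta -> M%:R * (a + b) < (J + 2)%:R.
  move=> ->; rewrite mulrDr divff ?gt_eqF// mulrC natrD; move: rhoJ; lra.
have B1 := @boundary_zone_card R d M J K M_gt0 C rho delta _ (JT _ _ erefl).
have B2 := @boundary_zone_card R d M J K M_gt0 C delta rho _ (JT _ _ (addrC _ _)).
have in1 := inner_cells_count; have out1 := meeting_cells_count.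
rewrite -/n in in1 out1; rewrite -/Z in B1 B2.
have V2 := vol_le_cells M_gt0 cell_cover.
have {}V1 : ((#|inner_cells|%:R / M%:R ^+ d)%:E <= vol C)%E.
  by apply: (vol_ge_cells (J := J)) => // g; rewrite inE => /asboolP.
have volfin : vol C \is a fin_num.
  by rewrite ge0_fin_numE ?vol_ge0// (le_lt_trans V2)// ltry.
rewrite -(fineK volfin) in V1 V2 *; move: (fine _) V1 V2 => v.
rewrite -EFinB abse_EFin !lee_fin.
have N0 : 0 < N%:R :> R by rewrite ltr0n; exact: (lattice_card_gt0 latL cardP).
have Md0 : 0 < M%:R ^+ d :> R by rewrite exprn_gt0.
rewrite ler_pdivrMr// ler_pdivlMr// => V1 V2.
have in2 : M%:R ^+ d * n%:R <= (#|inner_cells|%:R + Z%:R) * N%:R :> R.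
  rewrite -natrX -natrM -natrD -natrM ler_nat (leq_trans in1)//.
  by rewrite leq_mul2r leq_add2l B1 orbT.
have out2 : #|meeting_cells|%:R * N%:R <= M%:R ^+ d * n%:R + Z%:R * N%:R :> R.
  rewrite -natrX -!natrM -natrD ler_nat (leq_trans out1)//.
  by rewrite leq_add2l leq_mul2r B2 orbT.
rewrite ler_pdivlMr// -(ger0_norm (ltW Md0)) -normrM ler_norml mulrBl.
have nN : n%:R / N%:R * M%:R ^+ d = (M%:R ^+ d * n%:R) / N%:R :> R by ring.
rewrite nN.
have in3 : (M%:R ^+ d * n%:R) / N%:R <= #|inner_cells|%:R + Z%:R :> R.
  by rewrite ler_pdivrMr.
have out3 : #|meeting_cells|%:R - Z%:R <= (M%:R ^+ d * n%:R) / N%:R :> R.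
  by rewrite ler_pdivlMr// mulrBl lerBlDr.
by apply/andP; split; lra.
Qed.

End grid_discrepancy.

(** * The final estimate *)

Section final_estimate.
Context {R : realType}.

Lemma one_plus_expr_le2 (a : R) (n : nat) : 0 <= a -> n%:R * a <= 2^-1 ->
  (1 + a) ^+ n <= 1 + 2 * (n%:R * a).
Proof.
move=> a0; elim: n => [_|n IHn]; first by rewrite expr0 mul0r mulr0 addr0.
rewrite -natr1 mulrDl mul1r => na.
have {}IHn := IHn ltac:(lra); rewrite exprSr.
apply: (le_trans (ler_wpM2r _ IHn)); first by lra.
have : 0 <= n%:R * a by rewrite mulr_ge0.
by move: (n%:R * a) na => b; nra.
Qed.

(** The hypothesis [3 <= rho * M%:R] absorbs the rounding terms: it gives
    [J + 2 <= 2 rho M] and [M + 2 J <= (1 + 3 rho) M]. *)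
Lemma grid_error_le (d M J : nat) (s rho : R) : rho = 2 ^+ d * s / 2 ->
  (0 < d)%N -> (0 < M)%N -> 0 < s -> d%:R * 2 ^+ (2 * d.+1) * s < 1 ->
  3 <= rho * M%:R -> J%:R <= rho * M%:R + 1 ->
  (2 ^ d * (d * ((J + 2) * (M + 2 * J) ^ d.-1)))%:R <=
    d%:R * 2 ^+ (2 * d.+1) * s * M%:R ^+ d.
Proof.
case: d => // n rhoE _ M_gt0 s0 small rhoM Jrho; set d := n.+1 in rhoE small *.
have M0 : 0 < M%:R :> R by rewrite ltr0n.
have pE : 2 ^+ (2 * d.+1) = 4 * (2 ^+ d * 2 ^+ d) :> R.
  by rewrite -exprD [X in X * _](_ : 4 = 2 ^+ 2) -?exprD; [congr (_ ^+ _); lia|ring].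
have p2 : 2 <= 2 ^+ d :> R by rewrite exprS ler_peMr// exprn_ege1// ler1n.
rewrite pE in small *; rewrite !natrM !natrX natrD natrD natrM.
set p := 2 ^+ d in rhoE pE p2 small rhoM Jrho *.
have rho0 : 0 < rho by rewrite rhoE divr_gt0// mulr_gt0//; lra.
have dps : d%:R * (p * s) <= 8^-1.
  have : 0 <= d%:R * (p * s) by rewrite mulr_ge0// mulr_ge0//; lra.
  move: small; rewrite (_ : _ * s = 4 * p * (d%:R * (p * s))); last by ring.
  by move: (d%:R * (p * s)) => t; nra.
have KM : M%:R + 2 * J%:R <= M%:R * (1 + 3 * rho).
  by rewrite mulrDr mulr1 mulrCA (mulrC M%:R); lra.
have n3rho : n%:R * (3 * rho) <= 2^-1.
  have : n%:R * (3 * rho) <= d%:R * (3 * rho).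
    by rewrite ler_wpM2r ?ler_nat//; lra.
  rewrite [d%:R * (3 * rho)](_ : _ = 3 / 2 * (d%:R * (p * s))); first lra.
  by rewrite rhoE; field.
have growth : (1 + 3 * rho) ^+ n <= 2.
  have rho3 : 0 <= 3 * rho by lra.
  by apply: le_trans (one_plus_expr_le2 rho3 n3rho) _; lra.
have Kn : (M%:R + 2 * J%:R) ^+ n <= M%:R ^+ n * 2 :> R.
  apply: (@le_trans _ _ ((M%:R * (1 + 3 * rho)) ^+ n)).
    by rewrite lerXn2r ?nnegrE ?addr_ge0 ?mulr_ge0 ?addr_ge0//; lra.
  by rewrite exprMn ler_wpM2l// exprn_ge0// ltW.
have J2 : J%:R + 2 <= 2 * rho * M%:R by lra.
have JK : (J%:R + 2) * (M%:R + 2 * J%:R) ^+ n <=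
    2 * rho * M%:R * (M%:R ^+ n * 2).
  by apply: ler_pM => //; rewrite ?exprn_ge0// ?addr_ge0// mulr_ge0.
apply: (@le_trans _ _ (p * (d%:R * (2 * rho * M%:R * (M%:R ^+ n * 2))))).
  by rewrite ler_wpM2l// ?ler_wpM2l//; lra.
rewrite [leLHS](_ : _ = 2 * (d%:R * (p * p) * s * M%:R ^+ d)); last first.
  by rewrite [M%:R ^+ d]exprS rhoE; field.
rewrite [leRHS](_ : _ = 4 * (d%:R * (p * p) * s * M%:R ^+ d)); last by ring.
by rewrite ler_wpM2r// ?ler_nat// !mulr_ge0 ?exprn_ge0//; lra.
Qed.

Lemma isotropic_discrepancy_le d N (P : set 'rV[R]_d) (b : \bar R) :
  (forall C, segment_closed C -> C `<=` [set x | forall i, 0 <= x 0 i <= 1] ->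
     (`|(#|` fset_set (P `&` C)|%:R / N%:R)%:E - vol C| <= b)%E) ->
  (isotropic_discrepancy N P <= b)%E.
Proof.
move=> H; apply: ge_ereal_sup => _ [C [Ccvx C01] <-].
by apply: H => //; exact: segment_closed_convex_set.
Qed.

Lemma local_discrepancy_le1 d N (L C : set 'rV[R]_d) :
  integration_lattice L -> (lattice_points L #= `I_N)%card ->
  C `<=` [set x | forall i, 0 <= x 0 i <= 1] ->
  (`|(#|` fset_set (lattice_points L `&` C)|%:R / N%:R)%:E - vol C| <= 1)%E.
Proof.
move=> latL cardP C01; have V0 := vol_ge0 C; have V1 := vol_unit_cube_le1 C01.
have N0 : 0 < N%:R :> R by rewrite ltr0n; exact: (lattice_card_gt0 latL cardP).
have volfin : vol C \is a fin_num.
  by rewrite ge0_fin_numE// (le_lt_trans V1)// ltry.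
rewrite -(fineK volfin) in V0 V1 *; move: (fine _) V0 V1 => v.
rewrite -EFinB abse_EFin !lee_fin => v0 v1.
have : #|` fset_set (lattice_points L `&` C)|%:R / N%:R <= 1 :> R.
  rewrite ler_pdivrMr// mul1r ler_nat -[leqRHS](card_lattice_points cardP).
  have finP := finite_lattice_points cardP.
  apply: fsubset_leq_card; apply/fsubsetP => x.
  by rewrite !in_fset_set//; [rewrite !inE => -[]|exact: finite_setIl].
have : 0 <= #|` fset_set (lattice_points L `&` C)|%:R / N%:R :> R.
  by rewrite divr_ge0// ltW.
by rewrite ler_norml => ? ?; apply/andP; split; lra.
Qed.

End final_estimate.

Theorem theorem1 (R : realType) (d N : nat) (L : set 'rV[R]_d) :
  (0 < d)%N ->
  integration_lattice L ->
  lattice_points L #= `I_N ->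
  (isotropic_discrepancy N (lattice_points L)
     <= (d%:R * 2 ^+ (2 * d.+1) * spectral_test L)%:E)%E.
Proof.
move=> d_gt0 latL cardP; apply: isotropic_discrepancy_le => C Ccvx C01.
set s := spectral_test L; have s0 : 0 < s := spectral_test_gt0 d_gt0 latL cardP.
have [big|small] := leP 1 (d%:R * 2 ^+ (2 * d.+1) * s).
  by apply: le_trans (local_discrepancy_le1 latL cardP C01) _; rewrite lee_fin.
pose rho : R := 2 ^+ d * s / 2.
have p0 : 0 < 2 ^+ d :> R by rewrite exprn_gt0.
have rho0 : 0 < rho by rewrite divr_gt0// mulr_gt0.
pose M := (N`! * (Num.truncn (3 / rho)).+1)%N.
have M_gt0 : (0 < M)%N by rewrite muln_gt0 fact_gt0.
have M0 : 0 < M%:R :> R by rewrite ltr0n.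
have rhoM : 3 <= rho * M%:R.
  rewrite mulrC -ler_pdivrMr// (le_trans (ltW (truncnS_gt _)))// ler_nat.
  by rewrite leq_pmull// fact_gt0.
pose J := (Num.truncn (rho * M%:R)).+1.
have rhoJ : rho * M%:R <= J%:R by rewrite ltW// truncnS_gt.
have Jrho : J%:R <= rho * M%:R + 1.
  by rewrite -natr1 lerD2r truncn_le mulr_ge0// ltW.
have := grid_discrepancy latL cardP M_gt0 (ltn0Sn _ : 0 < J)%N (dvdn_mulr _ (dvdnn _))
  (covering_radius_le d_gt0 latL cardP) rhoJ Ccvx C01.
move=> /le_trans; apply; rewrite lee_fin ler_pdivrMr ?exprn_gt0//.
exact: (grid_error_le (rho := rho)).
Qed.
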